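(* Let $f : X \to Y$ be a continuous map from a quasi-Polish space $X$ to a $T_0$ topological space $Y$, and suppose there exists an $\mathcal{O}(Y)$-linear retraction $\phi : \mathcal{O}(X) \to \mathcal{O}(Y)$ of $f^{-1}$, i.e., a map preserving arbitrary unions such that $\phi(f^{-1}(V) \cap U) = V \cap \phi(U)$ for all open $V \subseteq Y$, $U \subseteq X$, and $\phi(X) = Y$. Then $f$ is surjective and $Y$ is quasi-Polish.
   Context: $\mathcal{O}(Z)$ denotes the set of open subsets of a topological space $Z$. Quasi-Polish spaces are in the sense of de Brecht (equivalently, spaces homeomorphic to $\boldsymbol{\Pi}^0_2$ subspaces of $\mathbb{S}^{\mathbb{N}}$, $\mathbb{S}$ the Sierpinski space). *)

(* Defs.v *)
From HB Require Import structures.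
From mathcomp Require Import all_boot all_order all_algebra.
From mathcomp Require Import all_classical all_reals all_analysis.

Set Implicit Arguments.
Unset Strict Implicit.
Unset Printing Implicit Defensive.

Local Open Scope classical_set_scope.

Definition sierpinski : Type := bool.

HB.instance Definition _ := Choice.on sierpinski.

(* The open sets are set0, [set true] and setT. *)
Definition sierpinski_open (U : set sierpinski) : Prop := U false -> U true.

Lemma sierpinski_openT : sierpinski_open setT.
Proof. by []. Qed.

Lemma sierpinski_openI : setI_closed sierpinski_open.
Proof. by move=> U V oU oV [/oU Ut /oV Vt]; split. Qed.

Lemma sierpinski_open_bigU (I : Type) (F : I -> set sierpinski) :
  (forall i, sierpinski_open (F i)) -> sierpinski_open (\bigcup_i F i).
Proof. by move=> oF [i _ /oF Fit]; exists i. Qed.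

HB.instance Definition _ := isOpenTopological.Build sierpinski
  sierpinski_openT sierpinski_openI sierpinski_open_bigU.

Definition sierpinski_nat : topologicalType :=
  prod_topology (fun _ : nat => sierpinski).

(* Borel hierarchy for spaces in which open sets need not be F_sigma: Sigma^0_2
   sets are countable unions of differences of open sets, so that Pi^0_2 is in
   general larger than G_delta. *)
Definition Sigma02 (T : topologicalType) (A : set T) : Prop :=
  exists U V : nat -> set T,
    [/\ forall n, open (U n), forall n, open (V n) &
        A = \bigcup_n (U n `\` V n)].

Definition Pi02 (T : topologicalType) (A : set T) : Prop := Sigma02 (~` A).

Definition homeomorphic (S T : topologicalType) : Prop :=
  exists (f : S -> T) (g : T -> S),
    [/\ continuous f, continuous g, cancel f g & cancel g f].

(* [set_type A] carries the subspace topology (unlike [subspace A]). *)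
Definition quasi_Polish (T : topologicalType) : Prop :=
  exists2 A : set sierpinski_nat, Pi02 A & homeomorphic T (set_type A).

(* A map O(X) -> O(Y) is encoded as a map on all subsets that sends open sets
   to open sets; its values on non-open sets are irrelevant. *)
Definition linear_retraction (X Y : topologicalType) (f : X -> Y)
    (phi : set X -> set Y) : Prop :=
  [/\ forall U, open U -> open (phi U),
      forall F : set (set X), F `<=` open ->
        phi (\bigcup_(U in F) U) = \bigcup_(U in F) phi U,
      forall V U, open V -> open U -> phi (f @^-1` V `&` U) = V `&` phi U &
      phi setT = setT].

(* Main.v *)
(** Fix a countable basis [B s] of X given by the cylinders of S^N. Linearity of
    phi makes the sets [phi (B s)] a basis of Y, so y |-> (s |-> y \in phi (B s))
    embeds the T0 space Y into S^N. For y in Y, the family of U with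
    y \in phi U is the family of open sets meeting some nonempty closed set C_y,
    and f @^-1` V is dense in C_y when y \in V and disjoint from C_y otherwise.
    The existence of such a closed set is expressible by countably many
    implications between open conditions on a point z of S^N, so the z
    satisfying them form a Pi^0_2 set. For each of them, the Baire category
    argument in C_z gives x in X whose image f x has code z. Hence the image of
    Y is exactly this Pi^0_2 set, and every y is of the form f x. *)

Require Import Defs.
From HB Require Import structures.
From mathcomp Require Import all_boot all_order all_algebra.
From mathcomp Require Import all_classical all_reals all_analysis.

Local Open Scope classical_set_scope.

(** * Cylinders as a basis of S^N *)

Definition cylinder (s : seq nat) : set sierpinski_nat := [set z | all z s].

Lemma cylinder_cat s t : cylinder (s ++ t) = cylinder s `&` cylinder t.
Proof.
by apply/seteqP; split=> z; rewrite /cylinder /= all_cat => /andP.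
Qed.

Lemma sub_cylinder s t : {subset s <= t} -> cylinder t `<=` cylinder s.
Proof. by move=> st z /allP zt; apply/allP => i /st /zt. Qed.

Lemma open_cylinder s : open (cylinder s).
Proof.
elim: s => [|i s IHs].
  rewrite (_ : cylinder [::] = setT); first exact: openT.
  by apply/seteqP; split.
rewrite (cylinder_cat [:: i] s); apply: openI => //.
have -> : cylinder [:: i] =
    proj i @^-1` [set true : sierpinski].
  by apply/seteqP; split => z; rewrite /cylinder /= /proj andbT.
by apply: open_comp => // z _; exact: proj_continuous.
Qed.

Lemma open_sierpinski_natP (O : set sierpinski_nat) :
  open O <-> forall z, O z -> exists2 s, cylinder s z & cylinder s `<=` O.
Proof.
split=> [oO z Oz|cylO]; last first.
  rewrite openE => z /cylO [s zs sO].
  by apply: filterS sO _; apply: open_nbhs_nbhs; split=> //; exact: open_cylinder.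
pose F := filter_from (cylinder^~ z) cylinder.
have FF : Filter F.
  apply: filter_from_filter; first by exists [::].
  by move=> s t zs zt; exists (s ++ t); rewrite cylinder_cat.
suff : F --> z by move=> /(_ O); apply; exact: open_nbhs_nbhs.
apply/cvg_sup => i A [_ [[B oB <-] Bz BA]].
(* An open set of S containing [false] is all of S, so only coordinates where [z] is true impose a
   constraint. *)
case: (boolP (z i)) => [zi|/negbTE zi].
  exists [:: i]; first by rewrite /cylinder /= zi.
  rewrite /cylinder => w /=; rewrite andbT => wi.
  by apply: BA; move: Bz; rewrite /= /proj zi wi.
exists [::] => // w _; apply: BA => /=; move: Bz; rewrite /= /proj zi => Bf.
by case: (w i) => //; exact: oB.
Qed.

(** * Pi^0_2 sets as countable systems of implications, and embeddings with Pi^0_2 range *)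

Lemma Pi02P (T : topologicalType) (A : set T) :
  Pi02 A <-> exists U V : nat -> set T,
    [/\ forall n, open (U n), forall n, open (V n) &
        A = [set z | forall n, U n z -> V n z]].
Proof.
split=> -[U [V [oU oV AUV]]]; exists U, V; split=> //.
  rewrite -[LHS]setCK AUV setC_bigcup; apply/seteqP; split=> z /= h n.
    by move=> Uz; apply: contrapT => Vz; exact: (h n I).
  by move=> _ [/h].
rewrite AUV; apply/seteqP; split=> z /=.
  by move=> /existsNP [n /not_implyP h]; exists n.
by move=> [n _ [Uz Vz]] /(_ n Uz).
Qed.

Lemma Pi02_implications (I : countType) (T : topologicalType)
    (U V : I -> set T) :
  (forall i, open (U i)) -> (forall i, open (V i)) ->
  Pi02 [set z | forall i, U i z -> V i z].
Proof.
move=> oU oV; apply/Pi02P.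
(* Numbers that code no index contribute the vacuous implication from [set0] to [set0]. *)
exists (fun n => if unpickle n is Some i then U i else set0).
exists (fun n => if unpickle n is Some i then V i else set0).
split=> [n|n|].
- by case: unpickle => // *; exact: open0.
- by case: unpickle => // *; exact: open0.
apply/seteqP; split=> z /= h => [n|i]; first by case: unpickle.
by move: (h (pickle i)); rewrite pickleK.
Qed.

Lemma Pi02I (T : topologicalType) (A B : set T) :
  Pi02 A -> Pi02 B -> Pi02 (A `&` B).
Proof.
move=> /Pi02P[U [V [oU oV ->]]] /Pi02P[U' [V' [oU' oV' ->]]].
pose sumf (F G : nat -> set T) (i : nat + nat) :=
  match i with inl n => F n | inr n => G n end.
rewrite (_ : _ `&` _ = [set z | forall i, sumf U U' i z -> sumf V V' i z]).
  by apply: Pi02_implications => -[].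
apply/seteqP; split=> z /=; first by move=> [h h'] [].
by move=> h; split=> n; [exact: (h (inl n))|exact: (h (inr n))].
Qed.

(* The third clause encodes continuity of the inverse of [c] on its range. *)
Definition Pi02_embedding {T : topologicalType} (c : T -> sierpinski_nat) :=
  [/\ injective c, continuous c,
      forall U x, open U -> U x ->
        exists2 s, cylinder s (c x) & c @^-1` cylinder s `<=` U &
      Pi02 (range c)].

(** Trades the homeomorphism with a subtype for a single map into S^N; conversely, the inverse on
    the range is obtained by choice. *)
Lemma quasi_PolishP (T : topologicalType) :
  quasi_Polish T <-> exists c : T -> sierpinski_nat, Pi02_embedding c.
Proof.
split=> [[A PA [f [g [cf cg fK gK]]]]|[c [cI cc cU Pc]]].
  exists (set_val \o f); split.
  - by move=> x y /val_inj /(can_inj fK).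
  - move=> x; apply: continuous_comp; first exact: cf.
    exact: initial_continuous.
  - move=> U x oU Ux.
    move/continuousP: (cg) => /(_ _ oU) [G oG GU].
    have : G (set_val (f x)).
      by rewrite -[G _]/((set_val @^-1` G) (f x)) GU /= fK.
    move=> /((open_sierpinski_natP G).1 oG) [s fxs sG]; exists s => // y /sG.
    by rewrite -[G _]/((set_val @^-1` G) (f y)) GU /= fK.
  - rewrite (_ : range _ = A) //; apply/seteqP; split=> [_ [x _ <-]|z Az].
      exact: set_valP.
    by exists (g (SigSub (mem_set Az))); rewrite //= gK.
have cx x : c x \in range c by apply/mem_set; exists x.
pose f x : set_type (range c) := SigSub (cx x).
have fS (z : set_type (range c)) : exists x, f x = z.
  by have [x _ xz] := set_valP z; exists x; apply: val_inj.
pose g z := sval (cid (fS z)).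
have gK : cancel g f by move=> z; exact: svalP (cid (fS z)).
have fI : injective f by move=> x y [] /cI.
have fK : cancel f g by move=> x; apply: fI; rewrite gK.
exists (range c) => //; exists f, g; split=> //.
  apply/continuousP => _ [G oG <-].
  by move/continuousP: cc => /(_ _ oG).
apply/continuousP => U oU.
(* By the third clause of [Pi02_embedding], this union of cylinders pulls back along [c] to exactly
   [U]. *)
exists (\bigcup_(s in [set s | c @^-1` cylinder s `<=` U]) cylinder s).
  by apply: bigcup_open => s _; exact: open_cylinder.
have gE z : c (g z) = set_val z by rewrite -[in RHS](gK z).
apply/seteqP; split=> z /=; first by move=> [s sU zs]; apply: sU; rewrite /= gE.
by move=> /(cU _ _ oU) [s zs sU]; exists s => //; rewrite -gE.
Qed.

(** * Baire category: codes of closed sets and generic points *)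

(** Rasiowa-Sikorski argument: words in [P] are conditions and [D n] is the n-th density
    requirement. Each requirement is met beyond every stage, since it may become effective only
    after finitely many extensions. *)
Lemma generic_chain (P : set (seq nat)) (D : nat -> seq nat -> seq nat -> Prop) :
  P [::] ->
  (forall n s, P s -> exists u, P (s ++ u) /\ D n s (s ++ u)) ->
  exists t : nat -> seq nat,
    [/\ forall k, P (t k),
        forall k m, (k <= m)%N -> {subset t k <= t m} &
        forall n k, exists2 m, (k <= m)%N & D n (t m) (t m.+1)].
Proof.
move=> P0 ext.
have /choice [u uP] (ns : nat * seq nat) :
    exists u, P ns.2 -> P (ns.2 ++ u) /\ D ns.1 ns.2 (ns.2 ++ u).
  case: (pselect (P ns.2)) => [/(ext ns.1)[u ?]|nP]; first by exists u.
  by exists [::] => /nP.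
(* Step [m] serves the requirement coded by the head of [decode m], so that
   each requirement is served infinitely often. *)
pose req m := head 0%N (CodeSeq.decode m).
pose t := fix t k := if k is k'.+1 then t k' ++ u (req k', t k') else [::].
have tP k : P (t k) by elim: k => //= k IHk; exact: (uP (req k, t k) IHk).1.
exists t; split=> // [k m|n k].
  elim: m => [|m IHm]; first by rewrite leqn0 => /eqP ->.
  rewrite leq_eqVlt => /predU1P[-> //|]; rewrite ltnS => /IHm tkm i /tkm itm.
  by rewrite /= mem_cat itm.
(* The code of a list exceeds its entries, so the stage [code [:: n; k]] comes after [k] while its
   head names requirement [n]. *)
have /= /and3P[_ /ltnW km _] := CodeSeq.ltn_code [:: n; k].
have reqE : req (CodeSeq.code [:: n; k]) = n by rewrite /req CodeSeq.codeK.
exists (CodeSeq.code [:: n; k]) => //; move: (CodeSeq.code _) reqE => m reqE.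
by rewrite reqE; exact: (uP (n, t m) (tP m)).2.
Qed.

(* With [z (code s)] read as "the cylinder of [s] meets the closed set C_z",
   the conditions say that C_z is a nonempty closed subset of the Pi^0_2 set
   [forall n, U n -> V n], and that the open set generated by [F i] is dense in
   C_z if [z i] and disjoint from C_z otherwise. *)
Definition dense_codes (U V : nat -> set sierpinski_nat)
    (F : nat -> set (seq nat)) : set sierpinski_nat :=
  let code := CodeSeq.code in
  [set z | [/\ z (code [::]),
      forall s t, {subset t <= s} -> z (code s) -> z (code t),
      forall n s, cylinder s `<=` U n -> z (code s) ->
        exists2 u, cylinder u `<=` V n & z (code (s ++ u)),
      forall i s, z i -> z (code s) -> exists2 u, F i u & z (code (s ++ u)) &
      forall i s, F i s -> z (code s) -> z i]].

Lemma open_coordinate n : open [set z : sierpinski_nat | z n].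
Proof.
rewrite (_ : [set _ | _] = cylinder [:: n]); first exact: open_cylinder.
by apply/seteqP; split=> z; rewrite /cylinder /= andbT.
Qed.

(** Allows side conditions on words alone, independent of the point [z], in the premises of the
    implications. *)
Lemma open_guard (T : topologicalType) (Q : Prop) (A : set T) :
  open A -> open [set z | Q /\ A z].
Proof.
move=> oA; case: (pselect Q) => q.
  by rewrite (_ : [set _ | _] = A) //; apply/seteqP; split=> z // [].
rewrite (_ : [set _ | _] = set0); first exact: open0.
by apply/seteqP; split=> z // [].
Qed.

Lemma open_exists2 (T : topologicalType) I (D : set I) (A : I -> set T) :
  (forall i, open (A i)) -> open [set z | exists2 i, D i & A i z].
Proof. by move=> oA; apply: bigcup_open => i _; exact: oA. Qed.

(** Each of the five clauses is a countable family of implications between open conditions: the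
    existentials over words are unions of open sets. *)
Lemma Pi02_dense_codes U V F : Pi02 (dense_codes U V F).
Proof.
pose Z n : set sierpinski_nat := [set z | z n].
pose C s := Z (CodeSeq.code s).
have oZ n : open (Z n) := open_coordinate n.
have oC s : open (C s) := oZ _.
pose A1 := [set z | forall i : unit, setT z -> C [::] z].
pose A2 := [set z | forall i : seq nat * seq nat,
  {subset i.2 <= i.1} /\ C i.1 z -> C i.2 z].
pose A3 := [set z | forall i : nat * seq nat,
  cylinder i.2 `<=` U i.1 /\ C i.2 z ->
  exists2 u, cylinder u `<=` V i.1 & C (i.2 ++ u) z].
pose A4 := [set z | forall i : nat * seq nat,
  (Z i.1 `&` C i.2) z -> exists2 u, F i.1 u & C (i.2 ++ u) z].
pose A5 := [set z | forall i : nat * seq nat,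
  F i.1 i.2 /\ C i.2 z -> Z i.1 z].
have -> : dense_codes U V F = A1 `&` (A2 `&` (A3 `&` (A4 `&` A5))).
  apply/seteqP; split=> z.
    move=> [h1 h2 h3 h4 h5]; split=> //; split; last split; last split.
    - by case=> s t [/=]; exact: h2.
    - by case=> s t [/=]; exact: h3.
    - by case=> s t [/=]; exact: h4.
    - by case=> s t [/=]; exact: h5.
  move=> [h1 [h2 [h3 [h4 h5]]]]; split.
  - exact: (h1 tt).
  - by move=> s t ? ?; apply: (h2 (s, t)).
  - by move=> s t ? ?; apply: (h3 (s, t)).
  - by move=> s t ? ?; apply: (h4 (s, t)).
  - by move=> s t ? ?; apply: (h5 (s, t)).
apply: Pi02I.
  by apply: (@Pi02_implications _ _ (fun=> setT) (fun=> C [::])) => // _;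
     exact: openT.
apply: Pi02I.
  apply: (@Pi02_implications _ _
    (fun i : seq nat * seq nat => [set z | {subset i.2 <= i.1} /\ C i.1 z]) (fun i => C i.2)) => // i.
  exact: open_guard.
apply: Pi02I.
  apply: (@Pi02_implications _ _
    (fun i : nat * seq nat => [set z | cylinder i.2 `<=` U i.1 /\ C i.2 z])
    (fun i => [set z | exists2 u, cylinder u `<=` V i.1 & C (i.2 ++ u) z])) => i.
    exact: open_guard.
  exact: (@open_exists2 _ _ [set u | cylinder u `<=` V i.1]).
apply: Pi02I.
  apply: (@Pi02_implications _ _ (fun i : nat * seq nat => Z i.1 `&` C i.2)
    (fun i => [set z | exists2 u, F i.1 u & C (i.2 ++ u) z])) => i.
    exact: openI.
  exact: open_exists2.
apply: (@Pi02_implications _ _ (fun i : nat * seq nat => [set z | F i.1 i.2 /\ C i.2 z])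
  (fun i => Z i.1)) => // i.
exact: open_guard.
Qed.

(* Baire category argument in the closed set C_z. *)
Lemma dense_codes_generic U V F z :
  (forall n, open (U n)) -> dense_codes U V F z ->
  exists w : sierpinski_nat, (forall n, U n w -> V n w) /\
    forall i, z i <-> exists2 s, F i s & cylinder s w.
Proof.
move=> oU [z0 zS zUV zF Fz].
pose P : set (seq nat) := [set s | z (CodeSeq.code s)].
(* Requirement [n] does two jobs: entering [V n] once inside [U n], and entering some member of
   [F n] when [z n] holds. *)
pose D n s s' := (cylinder s `<=` U n -> cylinder s' `<=` V n) /\
  (z n -> exists2 u, F n u & {subset u <= s'}).
have [n s Ps|t [tP t_sub tD]] := @generic_chain P D z0.
  have [u [Pu Du]] : exists u, P (s ++ u) /\
      (cylinder s `<=` U n -> cylinder u `<=` V n).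
    case: (pselect (cylinder s `<=` U n)) => [sU|nsU].
      by have [u uV Pu] := zUV _ _ sU Ps; exists u.
    by exists [::]; rewrite cats0; split=> // /nsU.
  have [v [Pv Dv]] : exists v, P ((s ++ u) ++ v) /\
      (z n -> exists2 v', F n v' & {subset v' <= v}).
    case: (pselect (z n)) => [zn|nzn].
      by have [v Fv Pv] := zF _ _ zn Pu; exists v; split=> // _; exists v.
    by exists [::]; rewrite cats0; split=> // /nzn.
  exists (u ++ v); rewrite catA; split=> //; split=> [/Du uV|/Dv [v' Fv' v'v]].
    by rewrite !cylinder_cat => x [[_ xu] _]; exact: uV.
  by exists v' => // i /v'v iv; rewrite mem_cat iv orbT.
(* The union of the words [t k] as sets of indices: the smallest point lying in all their
   cylinders. *)
pose w : sierpinski_nat := fun i => `[< exists k, i \in t k >].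
have wt k : cylinder (t k) w.
  by apply/allP => i itk; apply/asboolP; exists k.
have w_fin s : cylinder s w -> exists k, {subset s <= t k}.
  elim: s => [|i s IHs]; first by exists 0%N.
  rewrite /cylinder /= => /andP[/asboolP[k itk] /IHs[m stm]].
  exists (maxn k m) => j; rewrite inE => /predU1P[->|/stm].
    exact: t_sub (leq_maxl _ _) _ itk.
  exact: t_sub (leq_maxr _ _) _.
exists w; split=> [n|i].
  move=> /((open_sierpinski_natP _).1 (oU n)) [s /w_fin[k stk] sU].
  (* [U n] may be entered only at stage [k], so requirement [n] must be served at some stage
     [m >= k]. *)
  have [m km [DU _]] := tD n k.
  apply: DU (wt m.+1) => x /(sub_cylinder _ _ (t_sub _ _ km)).
  by move=> /(sub_cylinder _ _ stk) /sU.
split=> [zi|[s Fs /w_fin[k stk]]]; last by apply: Fz Fs _; exact: zS stk (tP k).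
have [m _ [_ /(_ zi) [u Fu ut]]] := tD i 0%N.
by exists u => //; exact: sub_cylinder ut _ (wt m.+1).
Qed.

(** * Consequences of linearity *)

Lemma linear_retraction_le (X Y : topologicalType) (f : X -> Y) phi U V :
  linear_retraction f phi -> open U -> open V -> U `<=` V -> phi U `<=` phi V.
Proof.
move=> [_ phiU _ _] oU oV UV.
have := phiU [set U; V]; rewrite !bigcup_setU !bigcup_set1 (setUidr UV) => -> //.
by move=> _ [] ->.
Qed.

Lemma linear_retractionK (X Y : topologicalType) (f : X -> Y) phi V :
  linear_retraction f phi -> open V -> phi (f @^-1` V) = V.
Proof.
move=> [_ _ phiI phiT] oV.
by rewrite -[f @^-1` V]setIT phiI ?phiT ?setIT //; exact: openT.
Qed.

(** In terms of the closed set C_y: if it meets [U], it meets some member of any open cover of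
    [U]. *)
Lemma linear_retraction_cover (X Y : topologicalType) (f : X -> Y) phi
    (I : Type) (J : set I) (B : I -> set X) U y :
  linear_retraction f phi -> open U -> (forall i, open (B i)) ->
  U `<=` \bigcup_(i in J) B i -> phi U y -> exists2 i, J i & phi (B i) y.
Proof.
move=> phiP oU oB UB; have oJB : open (\bigcup_(i in J) B i).
  by apply: bigcup_open => i _; exact: oB.
move=> /(linear_retraction_le _ _ _ _ _ _ phiP oU oJB UB).
have [_ phiU _ _] := phiP; rewrite -(bigcup_image J B id) phiU.
  by move=> [_ [i Ji <-] ?]; exists i.
by move=> _ [i _ <-].
Qed.

Theorem theorem2p6p10 (X Y : topologicalType) (f : X -> Y)
    (hX : quasi_Polish X) (hY : kolmogorov_space Y) (hf : continuous f)
    (hphi : exists phi : set X -> set Y, linear_retraction f phi) :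
  (forall y : Y, exists x : X, f x = y) /\ quasi_Polish Y.
Proof.
have [phi phiP] := hphi; have [phi_open _ phiI phiT] := phiP.
have [c [_ c_cont c_basis /Pi02P[U [V [oU oV rangeE]]]]] :=
  (quasi_PolishP X).1 hX.
have rangeP w : range c w <-> forall n, U n w -> V n w by rewrite rangeE.
have of_ G : open G -> open (f @^-1` G) by move/continuousP: hf => /(_ G).
pose B s := c @^-1` cylinder s.
have oB s : open (B s).
  by move/continuousP: c_cont; apply; exact: open_cylinder.
have B_cat s t : B (s ++ t) = B s `&` B t by rewrite /B cylinder_cat.
pose W i := phi (B (CodeSeq.decode i)).
have WE s : W (CodeSeq.code s) = phi (B s) by rewrite /W CodeSeq.codeK.
have oW i : open (W i) by exact: phi_open.
(* The basic sets [B s] with [s] in [F i] cover the preimage of [W i], so [F i] stands for that open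
   set. *)
pose F i : set (seq nat) := [set s | B s `<=` f @^-1` W i].
have F_basis i x : W i (f x) <-> exists2 s, F i s & B s x.
  split=> [Wfx|[s Fs /Fs //]].
  by have [s xs sW] := c_basis _ _ (of_ _ (oW i)) Wfx; exists s.
pose e y : sierpinski_nat := fun i => `[< W i y >].
have eP y : dense_codes U V F (e y).
  split.
  - by apply/asboolP; rewrite WE (_ : B [::] = setT) ?phiT //; apply/seteqP; split.
  - move=> s t ts /asboolP ys; apply/asboolP; move: ys; rewrite !WE.
    apply: (linear_retraction_le _ _ _ _ _ _ phiP) => // x.
    exact: sub_cylinder.
  - move=> n s sU /asboolP; rewrite WE.
    (* Points of [B s] have their image under [c] in [U n], hence in [V n], so the sets [B (s ++ u)]
       with [cylinder u] inside [V n] cover [B s]. *)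
    move=> /(linear_retraction_cover _ _ _ _ _ [set u | cylinder u `<=` V n]
               (fun u => B (s ++ u)) _ _ phiP (oB s)) [//|x xs|u uV yu].
      have /rangeP/(_ n (sU _ xs)) : range c (c x) by exists x.
      move=> /((open_sierpinski_natP _).1 (oV n)) [u xu uV].
      by exists u => //; rewrite B_cat.
    by exists u => //; apply/asboolP; rewrite WE.
  - move=> i s /asboolP yi /asboolP; rewrite WE => ys.
    have : phi (f @^-1` W i `&` B s) y by rewrite phiI.
    move=> /(linear_retraction_cover _ _ _ _ _ (F i) (fun u => B (s ++ u))
               _ _ phiP) [|//|x [/F_basis[u Fu xu] xs]|u Fu yu].
    + by apply: openI => //; exact: of_.
    + by exists u => //; rewrite B_cat.
    + by exists u => //; apply/asboolP; rewrite WE.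
  - move=> i s Fs /asboolP; rewrite WE => ys; apply/asboolP.
    rewrite -(linear_retractionK _ _ _ _ _ phiP (oW i)).
    exact: (linear_retraction_le _ _ _ _ _ _ phiP (oB s) (of_ _ (oW i)) Fs).
(* [G] is [phi] of its own preimage, hence a union of sets [phi (B s)]: the [W i] form a basis of
   [Y]. *)
have e_basis G y : open G -> G y -> exists2 i, e y i & W i `<=` G.
  move=> oG; rewrite -{1}(linear_retractionK _ _ _ _ _ phiP oG).
  move=> /(linear_retraction_cover _ _ _ _ _ [set s | B s `<=` f @^-1` G] B
             _ _ phiP (of_ _ oG) oB)[x /(c_basis _ _ (of_ _ oG))[s]|s sG ys].
    by exists s.
  exists (CodeSeq.code s); first by apply/asboolP; rewrite WE.
  rewrite WE -[X in _ `<=` X](linear_retractionK _ _ _ _ _ phiP oG).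
  exact: (linear_retraction_le _ _ _ _ _ _ phiP (oB s) (of_ _ oG)).
(* Points with equal codes lie in the same basic sets [W i], so the T0 axiom identifies them. *)
have e_inj : injective e.
  move=> y y' eyy'; apply: contrapT => /eqP /hY[A].
  have sep a b : e a = e b -> A \in nbhs a -> b \in ~` A -> False.
    rewrite !inE => eab; rewrite nbhsE => -[G [oG Ga] GA].
    have [i + WG] := e_basis _ _ oG Ga.
    by rewrite eab => /asboolP /WG /GA.
  by case=> -[]; apply: sep.
have e_onto z : dense_codes U V F z -> exists x, e (f x) = z.
  (* The generic point satisfies the implications defining [range c], hence is some [c x]; its
     second property says that [z i] holds exactly when [f x] lies in [W i]. *)
  move=> /(dense_codes_generic _ _ _ _ oU)[w [/rangeP[x _ xw] zP]].
  exists x; apply/funext => i; apply/idP/idP.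
    by move=> /asboolP /F_basis[s Fs xs]; apply/zP; exists s; rewrite // -xw.
  move=> /zP[s Fs ws]; apply/asboolP/F_basis; exists s => //.
  by rewrite /B /= xw.
(* Surjectivity: the code of [y] is also the code of some [f x], and [e] is injective. *)
split=> [y|]; first by have [x /e_inj] := e_onto _ (eP y); exists x.
apply/quasi_PolishP; exists e; split=> //.
- apply/continuousP => G oG.
  rewrite openE => y /((open_sierpinski_natP G).1 oG) [s ys sG].
  apply: (@filterS _ _ _ (e @^-1` cylinder s)) => [y' /sG //|].
  apply: open_nbhs_nbhs; split=> //.
  elim: s {ys sG} => [|i s IHs].
    rewrite (_ : _ @^-1` _ = setT); first exact: openT.
    by apply/seteqP; split.
  rewrite (_ : _ @^-1` _ = W i `&` e @^-1` cylinder s); first exact: openI.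
  apply/seteqP; split=> y'; rewrite /cylinder /=.
    by move=> /andP[/asboolP].
  by move=> [Wy es]; apply/andP; split=> //; apply/asboolP.
- move=> G y oG /(e_basis _ _ oG)[i yi WG]; exists [:: i].
    by rewrite /cylinder /= yi.
  by move=> y' /=; rewrite /cylinder /= andbT => /asboolP /WG.
- rewrite (_ : range e = dense_codes U V F); first exact: Pi02_dense_codes.
  apply/seteqP; split=> [_ [y _ <-] //|z /e_onto[x <-]].
  by exists (f x).
Qed.
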